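(* Let $n\ge 2$ be even. (i) There is a locally finite $n$-distributive variety which is not $(2n-1)$-reversed-modular; in particular, it is not $(2n-2)$-modular. (ii) There is a locally finite $n$-alvin variety which is not $(2n-3)$-modular.
   Context: All terms below are terms of a variety (or algebra) and equations are meant to hold identically. A sequence $t_0,\dots,t_n$ of ternary terms satisfies the basic equations (B) if $t_0(x,y,z)=x$, $t_n(x,y,z)=z$ and $t_h(x,y,x)=x$ for all $0\le h\le n$. - J\'onsson terms: (B) together with $t_h(x,x,z)=t_{h+1}(x,x,z)$ for even $h$ and $t_h(x,z,z)=t_{h+1}(x,z,z)$ for odd $h$, $0\le h<n$. - Alvin terms: (B) together with $t_h(x,z,z)=t_{h+1}(x,z,z)$ for even $h$ and $t_h(x,x,z)=t_{h+1}(x,x,z)$ for odd $h$, $0\le h<n$. A variety is $n$-distributive ($n$-alvin) if it has J\'onsson (alvin) terms $t_0,\dots,t_n$. Day terms: $4$-ary terms $u_0,\dots,u_m$ with $u_k(x,y,y,x)=x$ for all $0\le k\le m$, $u_0(x,y,z,w)=x$, $u_m(x,y,z,w)=w$, $u_k(x,x,w,w)=u_{k+1}(x,x,w,w)$ for even $k$ and $u_k(x,y,y,w)=u_{k+1}(x,y,y,w)$ for odd $k$ ($0\le k<m$). Reversed Day terms: the same but with ''even'' and ''odd'' exchanged in the last two conditions. A variety is $m$-modular ($m$-reversed-modular) if it has Day (reversed Day) terms $u_0,\dots,u_m$. *)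

(* Defs.v *)
From mathcomp Require Import all_boot.
From Stdlib Require List. Import List.ListNotations.
Notation In := List.In.
Set Implicit Arguments. Unset Strict Implicit. Unset Printing Implicit Defensive.

Inductive term (F : Type) (ar : F -> nat) : Type :=
| Var : nat -> term ar
| App : forall f : F, ('I_(ar f) -> term ar) -> term ar.

Record algebra (F : Type) (ar : F -> nat) := Algebra {
  carrier : Type;
  op : forall f : F, ('I_(ar f) -> carrier) -> carrier }.

Fixpoint eval (F : Type) (ar : F -> nat) (A : algebra ar) (v : nat -> carrier A)
  (t : term ar) : carrier A :=
  match t with
  | Var i => v i
  | App f args => @op F ar A f (fun j => eval v (args j))
  end.
Arguments eval {F ar} A v t.

(* A satisfies every identity s = t of the set Sigma; the variety defined by
   Sigma is the class of all such algebras. *)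
Definition models (F : Type) (ar : F -> nat) (Sigma : term ar -> term ar -> Prop)
  (A : algebra ar) : Prop :=
  forall s t, Sigma s t -> forall v : nat -> carrier A, eval A v s = eval A v t.

Definition env3 (T : Type) (x y z : T) : nat -> T :=
  fun i => match i with 0 => x | 1 => y | _ => z end.
Definition env4 (T : Type) (x y z w : T) : nat -> T :=
  fun i => match i with 0 => x | 1 => y | 2 => z | _ => w end.

Definition ev3 (F : Type) (ar : F -> nat) (A : algebra ar) (t : term ar)
  (x y z : carrier A) := eval A (env3 x y z) t.
Definition ev4 (F : Type) (ar : F -> nat) (A : algebra ar) (t : term ar)
  (x y z w : carrier A) := eval A (env4 x y z w) t.

Definition n_distributive (F : Type) (ar : F -> nat)
  (Sigma : term ar -> term ar -> Prop) (n : nat) : Prop :=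
  exists t : nat -> term ar,
    forall A : algebra ar, models Sigma A -> forall x y z : carrier A,
      [/\ ev3 (t 0) x y z = x, ev3 (t n) x y z = z,
          (forall h, h <= n -> ev3 (t h) x y x = x) &
          (forall h, h < n ->
             if ~~ odd h then ev3 (t h) x x z = ev3 (t h.+1) x x z
             else ev3 (t h) x z z = ev3 (t h.+1) x z z)].

Definition n_alvin (F : Type) (ar : F -> nat)
  (Sigma : term ar -> term ar -> Prop) (n : nat) : Prop :=
  exists t : nat -> term ar,
    forall A : algebra ar, models Sigma A -> forall x y z : carrier A,
      [/\ ev3 (t 0) x y z = x, ev3 (t n) x y z = z,
          (forall h, h <= n -> ev3 (t h) x y x = x) &
          (forall h, h < n ->
             if ~~ odd h then ev3 (t h) x z z = ev3 (t h.+1) x z z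
             else ev3 (t h) x x z = ev3 (t h.+1) x x z)].

Definition m_modular (F : Type) (ar : F -> nat)
  (Sigma : term ar -> term ar -> Prop) (m : nat) : Prop :=
  exists u : nat -> term ar,
    forall A : algebra ar, models Sigma A -> forall x y z w : carrier A,
      [/\ (forall k, k <= m -> ev4 (u k) x y y x = x),
          ev4 (u 0) x y z w = x, ev4 (u m) x y z w = w &
          (forall k, k < m ->
             if ~~ odd k then ev4 (u k) x x w w = ev4 (u k.+1) x x w w
             else ev4 (u k) x y y w = ev4 (u k.+1) x y y w)].

Definition m_reversed_modular (F : Type) (ar : F -> nat)
  (Sigma : term ar -> term ar -> Prop) (m : nat) : Prop :=
  exists u : nat -> term ar,
    forall A : algebra ar, models Sigma A -> forall x y z w : carrier A,
      [/\ (forall k, k <= m -> ev4 (u k) x y y x = x),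
          ev4 (u 0) x y z w = x, ev4 (u m) x y z w = w &
          (forall k, k < m ->
             if ~~ odd k then ev4 (u k) x y y w = ev4 (u k.+1) x y y w
             else ev4 (u k) x x w w = ev4 (u k.+1) x x w w)].

Definition finite_alg (F : Type) (ar : F -> nat) (A : algebra ar) : Prop :=
  exists l : list (carrier A), forall a : carrier A, In a l.

Definition fin_generated (F : Type) (ar : F -> nat) (A : algebra ar) : Prop :=
  exists gens : list (carrier A), forall a : carrier A,
    exists (t : term ar) (v : nat -> carrier A),
      (forall i, In (v i) gens) /\ a = eval A v t.

Definition locally_finite (F : Type) (ar : F -> nat)
  (Sigma : term ar -> term ar -> Prop) : Prop :=
  forall A : algebra ar, models Sigma A -> fin_generated A -> finite_alg A.

(* Main.v *)
Require Import Defs.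
From mathcomp Require Import all_boot zify.
From Stdlib Require Import Classical FunctionalExtensionality.
Set Implicit Arguments. Unset Strict Implicit. Unset Printing Implicit Defensive.

(** For n = 2N the variety is generated by N two-element algebras, the [level]s
    0, ..., N-1.  At level j the basic terms start as the first projection
    (t_h for h <= j), end as the third projection (t_h for h >= n - j), equal
    x /\ z in between, and the two transition terms are x /\ (y \/ z) and
    z /\ (y \/ x), or the same with y complemented; complemented and plain
    levels alternate.  At the innermost level the two transitions merge into
    the majority, respectively the Pixley, operation.

    If a term takes the value 1 under two valuations at level j and only one
    variable is 1 under both of them, then at level j + 1 the term is the
    projection on that variable: where t_h is a meet at level j, it satisfies
    t_h(x,y,x) = x at level j + 1.  For Day terms one of the valuations comes
    from u(x,y,y,x) = x and the other from following the linking equations.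
    Hence, passing from a level to the next one, at each end of the sequence
    one more term (complemented level) or three more terms (plain level, where
    term operations are monotone) become projections, and a sequence that is
    too short collapses at the innermost level. *)

(** * Local finiteness of a variety generated by finitely many finite algebras *)

Section GeneratedVariety.
Variables (F : Type) (ar : F -> nat) (I T : finType).
Variable ops : I -> forall f : F, ('I_(ar f) -> T) -> T.

Definition gen_alg (i : I) : algebra ar := Algebra (ops i).

Definition gen_identities (s t : term ar) : Prop :=
  forall i (v : nat -> T), eval (gen_alg i) v s = eval (gen_alg i) v t.

Lemma gen_alg_models i : models gen_identities (gen_alg i).
Proof. by move=> s t st v; apply: st. Qed.

Lemma bounded_variables (A : algebra ar) (gens : list (carrier A)) a0
    (v : nat -> carrier A) (t : term ar) :
  (forall i, In (v i) gens) ->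
  exists t' : term ar,
    eval A (fun i => List.nth i gens a0) t' = eval A v t /\
    forall i (w w' : nat -> T), (forall k, k < size gens -> w k = w' k) ->
      eval (gen_alg i) w t' = eval (gen_alg i) w' t'.
Proof.
move=> vgens; elim: t => [k|f args IH].
  have [m [mlt mk]] := List.In_nth _ _ a0 (vgens k).
  exists (Var _ m); split=> //= i w w' ww'; apply: ww'; exact/ltP.
have [args' argsP] := fin_all_exists IH.
exists (App args'); split=> /=.
  congr (op _); apply: functional_extensionality => j.
  by case: (argsP j).
move=> i w w' ww'; congr (ops i _); apply: functional_extensionality => j.
by case: (argsP j) => _; apply.
Qed.

(** Terms in [size gens] variables with equal tables over the generating algebras form an identity,
    hence agree in [A]; there are only finitely many tables. *)
Lemma gen_locally_finite : locally_finite gen_identities.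
Proof.
move=> A Amod [[|a0 l] gensP].
  by exists nil => a; have [t [v [vin _]]] := gensP a; case: (vin 0).
set gens := (a0 :: l)%list in gensP.
pose bounded (t : term ar) := forall i (w w' : nat -> T),
  (forall k, k < size gens -> w k = w' k) ->
  eval (gen_alg i) w t = eval (gen_alg i) w' t.
(* [inord] sends out-of-range indices to 0, which bounded terms do not see. *)
pose table (t : term ar) : {ffun I * {ffun 'I_(size l).+1 -> T} -> T} :=
  [ffun p : I * {ffun 'I_(size l).+1 -> T} =>
     eval (gen_alg p.1) (fun k => p.2 (inord k)) t].
pose val t := eval A (fun i => List.nth i gens a0) t.
have table_inj t t' : bounded t -> bounded t' -> table t = table t' ->
    val t = val t'.
  move=> bt bt' /ffunP tt'; apply: Amod => i v.
  have := tt' (i, [ffun k : 'I_(size l).+1 => v k]); rewrite !ffunE /= => tt'i.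
  have vE k : k < size gens ->
      v k = [ffun k : 'I_(size l).+1 => v k] (inord k).
    by move=> kl; rewrite ffunE inordK.
  by rewrite (bt i _ _ vE) (bt' i _ _ vE).
(* Collect one value for each table realised by a bounded term; realisability is decided
   classically. *)
have [L LP] : exists L : list (carrier A), forall t, bounded t ->
    table t \in enum {: {ffun I * {ffun 'I_(size l).+1 -> T} -> T}} ->
    In (val t) L.
  elim: (enum _) => [|phi s [L LP]]; first by exists nil.
  have [[t0 [bt0 t0phi]]|no] :=
      classic (exists t0, bounded t0 /\ table t0 = phi).
    exists (val t0 :: L)%list => t bt; rewrite inE => /orP[/eqP tphi|ts].
      by left; apply: table_inj; rewrite ?t0phi ?tphi.
    by right; apply: LP.
  exists L => t bt; rewrite inE => /orP[/eqP tphi|]; last exact: LP.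
  by case: no; exists t.
exists L => a; have [t [v [vin ->]]] := gensP a.
have [t' [<- bt']] := bounded_variables a0 t vin.
by apply: LP => //; rewrite mem_enum.
Qed.

End GeneratedVariety.

(** * The levels *)

(* [e (+) odd j] tells whether y is complemented; the outermost level is plain
   in the distributive case ([e = false]), complemented in the alvin one. *)
Definition level_op (e : bool) (N j h : nat) (x y z : bool) : bool :=
  if h <= j then x else if N.*2 - j <= h then z else
  x && z || (y (+) (e (+) odd j)) &&
            ((h == j.+1) && x || (h.+1 == N.*2 - j) && z).

Lemma level_op_idem e N j h x y : level_op e N j h x y x = x.
Proof.
rewrite /level_op; case: ifP => // _; case: ifP => // _.
by case: x; rewrite ?andbF ?andbT.
Qed.

Lemma level_op_last e N j x y z :
  j < N -> level_op e N j N.*2 x y z = z.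
Proof.
move=> jN; rewrite /level_op leq_subr ifF //; lia.
Qed.

(** With [y] so specialised, a transition term becomes a projection towards its outer side and
    [x && z] towards its inner side; merged transitions have two outer sides. *)
Lemma level_op_link e N j h x z : j < N -> h < N.*2 ->
  level_op e N j h x (if e (+) odd h then z else x) z =
  level_op e N j h.+1 x (if e (+) odd h then z else x) z.
Proof.
move=> jN hN; rewrite /level_op.
have [hj|jh] := leqP h.+1 j; first by rewrite ifT //; lia.
have [hj|jh'] := leqP h j.
  have -> : h = j by lia.
  rewrite ifF; last by lia.
  rewrite eqxx; case: (_ == _); case: x; case: z; case: e; case: (odd j) => //=.
have [nh|hn] := leqP (N.*2 - j) h; first by rewrite ifT //; lia.
have odd_sym : h.+1 = N.*2 - j -> odd h = ~~ odd j by lia.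
have [nh|hn'] := leqP (N.*2 - j) h.+1.
  have hE : h.+1 = N.*2 - j by lia.
  rewrite hE eqxx (odd_sym hE).
  by case: (_ == _); case: x; case: z; case: e; case: (odd j).
have -> : (h.+1 == N.*2 - j) = false by lia.
have -> : (h.+1 == j.+1) = false by lia.
have [hE|_] := eqVneq h j.+1; have [hE'|_] := eqVneq h.+2 (N.*2 - j) => //=.
- by lia.
- by rewrite hE; case: x; case: z; case: e; rewrite /=; case: (odd j).
- have -> : odd h = odd j by lia.
  by case: x; case: z; case: e; rewrite /=; case: (odd j).
Qed.

Lemma level_op_monotone e N j h (x y z x' y' z' : bool) :
  e (+) odd j = false ->
  (x -> x') -> (y -> y') -> (z -> z') ->
  level_op e N j h x y z -> level_op e N j h x' y' z'.
Proof.
move=> ej xx yy zz; rewrite /level_op ej !addbF.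
case: ifP => // _; case: ifP => // _.
case: x y z x' y' z' xx yy zz => [] [] [] [] [] [] xx yy zz;
  by rewrite ?(xx isT) ?(yy isT) ?(zz isT); case: (_ == _); case: (_ == _);
     rewrite //= ?(xx isT) ?(yy isT) ?(zz isT).
Qed.

Definition arg3 (k : nat) (lt_k3 : k < 3) : 'I_3 := Ordinal lt_k3.

Definition ar3 (_ : nat) : nat := 3.

Definition level_ops (e : bool) (N : nat) (j : 'I_N) (h : nat)
    (a : 'I_(ar3 h) -> bool) : bool :=
  level_op e N j h (a (@arg3 0 isT)) (a (@arg3 1 isT)) (a (@arg3 2 isT)).

Definition level_alg (e : bool) (N : nat) (j : 'I_N) : algebra ar3 :=
  gen_alg (@level_ops e N) j.

Definition level_identities (e : bool) (N : nat) : term ar3 -> term ar3 -> Prop :=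
  gen_identities (@level_ops e N).

(** The renaming [s] turns equations with repeated variables into identities between terms, the form
    [models] needs. *)
Definition basic_term (s : nat -> nat) (h : nat) : term ar3 :=
  @App nat ar3 h (fun i => Var _ (s i)).

Lemma ev3_basic_term (A : algebra ar3) (v : nat -> carrier A) p q r h :
  @ev3 _ _ A (basic_term id h) (v p) (v q) (v r) =
  eval A v (basic_term (env3 p q r) h).
Proof.
rewrite /ev3 /=; congr (op _); apply: functional_extensionality.
by case=> [[|[|[]]]].
Qed.

Section BasicTerms.
Variables (e : bool) (N : nat) (A : algebra ar3).
Hypothesis Amod : models (level_identities e N) A.

Lemma basic_term_first (x y z : carrier A) :
  ev3 (basic_term id 0) x y z = x.
Proof.
rewrite (@ev3_basic_term A (env3 x y z) 0 1 2).
by rewrite (Amod (t := Var _ 0)).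
Qed.

Lemma basic_term_last (x y z : carrier A) :
  ev3 (basic_term id N.*2) x y z = z.
Proof.
rewrite (@ev3_basic_term A (env3 x y z) 0 1 2).
by rewrite (Amod (t := Var _ 2)) // => j v; apply: level_op_last.
Qed.

Lemma basic_term_idem h (x y : carrier A) :
  ev3 (basic_term id h) x y x = x.
Proof.
rewrite (@ev3_basic_term A (env3 x y x) 0 1 0).
by rewrite (Amod (t := Var _ 0)) // => j v; apply: level_op_idem.
Qed.

Lemma basic_term_link h (x z : carrier A) : h < N.*2 ->
  ev3 (basic_term id h) x (if e (+) odd h then z else x) z =
  ev3 (basic_term id h.+1) x (if e (+) odd h then z else x) z.
Proof.
move=> hN; pose b := if e (+) odd h then 2 else 0.
have -> : (if e (+) odd h then z else x) = env3 x x z b.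
  by rewrite /b; case: ifP.
rewrite !(@ev3_basic_term A (env3 x x z) 0 b 2); apply: Amod => j v /=.
have := @level_op_link e N j h (v 0) (v 2) (ltn_ord j) hN.
by rewrite /b /level_ops /=; case: ifP.
Qed.

End BasicTerms.

Lemma level_distributive N : n_distributive (level_identities false N) N.*2.
Proof.
exists (basic_term id) => A Amod x y z; split.
- exact: basic_term_first Amod _ _ _.
- exact: basic_term_last Amod _ _ _.
- by move=> h _; apply: basic_term_idem Amod _ _ _.
- by move=> h hN; have := basic_term_link Amod x z hN; case: (odd h).
Qed.

Lemma level_alvin N : n_alvin (level_identities true N) N.*2.
Proof.
exists (basic_term id) => A Amod x y z; split.
- exact: basic_term_first Amod _ _ _.
- exact: basic_term_last Amod _ _ _.
- by move=> h _; apply: basic_term_idem Amod _ _ _.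
- by move=> h hN; have := basic_term_link Amod x z hN; case: (odd h).
Qed.

(** * Terms across levels *)

(** Induction on [p]. At level [j] the operation lies below its first argument if [h <= j.+1], below
    its third if [N.*2 - j.+1 <= h], and below both in between; at level [j.+1] it is then the first
    projection, the third, or idempotent in [x] and [z]. *)
Lemma next_level_projection e N (j j' : 'I_N) (v1 v2 v : nat -> bool) a
    (p : term ar3) : val j' = j.+1 ->
  (forall i, v1 i -> v2 i -> v i = a) ->
  eval (level_alg e j) v1 p -> eval (level_alg e j) v2 p ->
  eval (level_alg e j') v p = a.
Proof.
move=> j'E va; have j'N := ltn_ord j'; rewrite j'E in j'N.
elim: p => [i|h args IH] /=; first exact: va.
rewrite /level_ops j'E.
have IHx := IH (@arg3 0 isT); have IHz := IH (@arg3 2 isT).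
have [hj|jh] := leqP h j.+1.
  have lowE b c d : level_op e N j h b c d -> b.
    rewrite /level_op; case: ifP => // _; rewrite ifF; last by lia.
    have -> : (h.+1 == N.*2 - j) = false by lia.
    by case: b; rewrite //= ?andbF.
  by move=> /lowE ? /lowE ?; rewrite /level_op hj; apply: IHx.
have [nh|hn] := leqP (N.*2 - j.+1) h.
  have highE b c d : level_op e N j h b c d -> d.
    rewrite /level_op ifF; last by lia.
    case: ifP => // _.
    have -> : (h == j.+1) = false by lia.
    by case: d; rewrite //= ?andbF.
  move=> /highE ? /highE ?; rewrite /level_op leqNgt jh /= nh; exact: IHz.
have midE b c d : level_op e N j h b c d -> b && d.
  rewrite /level_op ifF; last by lia.
  rewrite ifF; last by lia.
  have -> : (h == j.+1) = false by lia.
  have -> : (h.+1 == N.*2 - j) = false by lia.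
  by rewrite andbF orbF.
move=> /midE/andP[? ?] /midE/andP[? ?].
by rewrite IHx // IHz // level_op_idem.
Qed.

Lemma plain_level_monotone e N (j : 'I_N) (v w : nat -> bool) (p : term ar3) :
  e (+) odd j = false -> (forall i, v i -> w i) ->
  eval (level_alg e j) v p -> eval (level_alg e j) w p.
Proof.
move=> ej vw; elim: p => [i|h args IH] /=; first exact: vw.
by apply: level_op_monotone => //; apply: IH.
Qed.

(** * Day terms *)

Section DayTerms.
Variables (e : bool) (m : nat).

(* [e = true] for Day terms, [e = false] for reversed Day terms. *)
Definition day_link (g : nat -> bool -> bool -> bool -> bool -> bool) : Prop :=
  forall k x y w, k < m ->
    if e (+) odd k then g k x x w w = g k.+1 x x w w
    else g k x y y w = g k.+1 x y y w.

Definition flip (g : nat -> bool -> bool -> bool -> bool -> bool) :=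
  fun k x y z w => g (m - k) w z y x.

(** Since [m] is odd, [k] and [m - k.+1] have the same parity. *)
Lemma day_link_flip g : odd m -> day_link g -> day_link (flip g).
Proof.
move=> om gl k x y w km; have kE : m - k = (m - k.+1).+1 by lia.
have kodd : odd (m - k.+1) = odd k by lia.
rewrite /flip kE; have := gl (m - k.+1) w y x; rewrite kodd.
by move=> /(_ ltac:(lia)); case: ifP => _ ->.
Qed.

Definition gain (j : nat) : nat := if e (+) odd j then 1 else 3.

(* u_k with k = [settled j] is the first projection at level j, and u_(m - k)
   the last one. *)
Fixpoint settled (j : nat) : nat :=
  if j is j'.+1 then settled j' + gain j' else 0.

Lemma odd_settled j : odd (settled j) = odd j.
Proof. by elim: j => //= j IH; rewrite oddD IH /gain; case: ifP; rewrite addbT. Qed.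

Lemma settledD j : settled j + settled j.+1 = 4 * j + gain 0.
Proof.
elim: j => [|j IH] //; rewrite [settled j.+2]/= -/(settled j.+1).
have -> : settled j.+1 + (settled j.+1 + gain j.+1)
        = settled j + settled j.+1 + (gain j + gain j.+1).
  by rewrite [settled j.+1]/=; lia.
rewrite IH; have -> : gain j + gain j.+1 = 4; last by lia.
by rewrite /gain /=; case: e; case: (odd j).
Qed.

(** The value 1 is carried along one link at a complemented level and along three at a plain one,
    where monotonicity raises [y], then [z], between links. *)
Lemma settled_next g j : day_link g -> settled j.+1 <= m ->
  (forall x y z w, g (settled j) x y z w = x) ->
  (e (+) odd j = false -> forall k (y z y' z' : bool), (y -> y') -> (z -> z') ->
     g k true y z false -> g k true y' z' false) ->
  exists b, g (settled j.+1) true true b false.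
Proof.
move=> gl jm gx gmono; have cj := odd_settled j.
move: jm; rewrite /= /gain; case: ifP => ej jm.
  exists false; have := gl (settled j) true true false; rewrite cj ej.
  by rewrite addn1 in jm *; move=> /(_ jm) <-; rewrite gx.
exists true; move: (settled j) cj jm gx => c cj jm gx.
have g1 : g c.+1 true false false false.
  have := gl c true false false; rewrite cj ej.
  by move=> /(_ ltac:(lia)) <-; rewrite gx.
have g2 : g c.+2 true true false false.
  have := gl c.+1 true true false; rewrite /= cj addbN ej.
  by move=> /(_ ltac:(lia)) <-; apply: gmono g1.
have := gl c.+2 true true false; rewrite /= negbK cj ej addn3.
by move=> /(_ ltac:(lia)) <-; apply: gmono g2.
Qed.

End DayTerms.

(** * Collapse of a sequence of critical length *)

Section NoDayTerms.
Variables (e : bool) (N : nat) (u : nat -> term ar3).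
Hypothesis N_gt0 : 0 < N.
(** By [settledD] this is [settled e N.-1 + settled e N], so that the two ends meet at the innermost
    level. *)
Let m := 4 * N.-1 + gain e 0.
Let g (j : 'I_N) k (x y z w : bool) : bool :=
  @ev4 _ _ (level_alg e j) (u k) x y z w.
Hypothesis u_idem : forall j k x y, k <= m -> g j k x y y x = x.
Hypothesis u_first : forall j x y z w, g j 0 x y z w = x.
Hypothesis u_last : forall j x y z w, g j m x y z w = w.
Hypothesis u_link : forall j, day_link e m (g j).

Lemma odd_m : odd m.
Proof. by rewrite /m /gain oddD oddM /=; case: ifP. Qed.

Lemma settled_le_m j : j < N -> settled e j + settled e j.+1 <= m.
Proof. by move=> jN; rewrite settledD /m; lia. Qed.

Lemma g_monotone (j : 'I_N) k (x y z w x' y' z' w' : bool) :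
  e (+) odd j = false ->
  (x -> x') -> (y -> y') -> (z -> z') -> (w -> w') ->
  g j k x y z w -> g j k x' y' z' w'.
Proof.
by move=> ej xx yy zz ww; apply: plain_level_monotone => // -[|[|[|]]].
Qed.

Lemma settled_left (j : 'I_N) :
  (forall x y z w, g j (settled e j) x y z w = x) ->
  exists b, g j (settled e j.+1) true true b false.
Proof.
move=> gx; apply: settled_next (u_link j) _ gx _.
  by have := settled_le_m (ltn_ord j); lia.
by move=> ej k y z y' z' yy zz; apply: g_monotone.
Qed.

Lemma settled_right (j : 'I_N) :
  (forall x y z w, g j (m - settled e j) x y z w = w) ->
  exists b, g j (m - settled e j.+1) false b true true.
Proof.
move=> gw; apply: (settled_next (day_link_flip odd_m (u_link j))).
- by have := settled_le_m (ltn_ord j); lia.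
- by move=> x y z w; rewrite /flip gw.
by move=> ej k y z y' z' yy zz; apply: g_monotone.
Qed.

Lemma settled_projections (j : 'I_N) :
  (forall x y z w, g j (settled e j) x y z w = x) /\
  (forall x y z w, g j (m - settled e j) x y z w = w).
Proof.
case: j => j; elim: j => [|j IH] jN.
  by rewrite subn0; split.
have jN' := ltnW jN; have [IHx IHw] := IH jN'.
have jm := settled_le_m jN'; rewrite /= in jm.
have [b gb] := settled_left IHx; have [b' gb'] := settled_right IHw.
split=> x y z w.
- have gi : g (Ordinal jN') (settled e j.+1) true false false true.
    by rewrite u_idem //=; lia.
  (* Only [x] is 1 in both (1,1,b,0) and (1,0,0,1). *)
  by apply: (next_level_projection _ _ gb gi) => // -[|[|[|]]].
- have gi : g (Ordinal jN') (m - settled e j.+1) true false false true.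
    by rewrite u_idem // leq_subr.
  by apply: (next_level_projection _ _ gb' gi) => // -[|[|[|]]].
Qed.

Lemma no_day_terms : False.
Proof.
have jN : N.-1 < N by rewrite prednK.
have [gx gw] := settled_projections (Ordinal jN).
have [b] := settled_left gx.
(* The term with value 1 at (1,1,b,0) is also the last projection, whose value there is 0. *)
have -> : settled e (Ordinal jN).+1 = m - settled e (Ordinal jN).
  by have := settledD e N.-1; rewrite /m /=; lia.
by rewrite gw.
Qed.

End NoDayTerms.

Lemma level_not_modular N : 0 < N ->
  ~ m_modular (level_identities true N) (4 * N - 3).
Proof.
move=> N0 [u uP]; have mE : 4 * N - 3 = 4 * N.-1 + gain true 0.
  by rewrite /gain /=; lia.
rewrite {}mE in uP.
have {}uP j := uP (level_alg true j) (@gen_alg_models _ _ _ _ (@level_ops true N) j).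
apply: (@no_day_terms true N u N0) => j.
- by move=> k x y km; case: (uP j x y y x) => /(_ k km).
- by move=> x y z w; case: (uP j x y z w).
- by move=> x y z w; case: (uP j x y z w).
- by move=> k x y w km; case: (uP j x y y w) => _ _ _ /(_ k km); case: (odd k).
Qed.

Lemma level_not_reversed_modular N : 0 < N ->
  ~ m_reversed_modular (level_identities false N) (4 * N - 1).
Proof.
move=> N0 [u uP]; have mE : 4 * N - 1 = 4 * N.-1 + gain false 0.
  by rewrite /gain /=; lia.
rewrite {}mE in uP.
have {}uP j := uP (level_alg false j) (@gen_alg_models _ _ _ _ (@level_ops false N) j).
apply: (@no_day_terms false N u N0) => j.
- by move=> k x y km; case: (uP j x y y x) => /(_ k km).
- by move=> x y z w; case: (uP j x y z w).
- by move=> x y z w; case: (uP j x y z w).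
- by move=> k x y w km; case: (uP j x y y w) => _ _ _ /(_ k km); case: (odd k).
Qed.

(** Prepending the first projection shifts the parity of every link. *)
Lemma modular_reversed_modular (F : Type) (ar : F -> nat)
    (Sigma : term ar -> term ar -> Prop) m :
  m_modular Sigma m -> m_reversed_modular Sigma m.+1.
Proof.
move=> [u uP]; exists (fun k => if k is k'.+1 then u k' else Var _ 0).
move=> A Amod x y z w; have [_ _ um _] := uP A Amod x y z w.
split=> //.
- by case=> // k km; case: (uP A Amod x y y x) => /(_ k km).
- case=> [_|k km] /=.
    by case: (uP A Amod x y y w) => _ ->.
  by case: (uP A Amod x y z w) => _ _ _ /(_ k km); case: (odd k).
Qed.

Theorem theorem4p1 (n : nat) (Hn : 2 <= n) (Hev : ~~ odd n) :
  (exists (F : Type) (ar : F -> nat) (Sigma : term ar -> term ar -> Prop),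
      [/\ locally_finite Sigma, n_distributive Sigma n,
          ~ m_reversed_modular Sigma (2 * n - 1) &
          ~ m_modular Sigma (2 * n - 2)]) /\
  (exists (F : Type) (ar : F -> nat) (Sigma : term ar -> term ar -> Prop),
      [/\ locally_finite Sigma, n_alvin Sigma n &
          ~ m_modular Sigma (2 * n - 3)]).
Proof.
have nE : n = n./2.*2 by rewrite even_halfK.
have N0 : 0 < n./2 by lia.
have m1 : 2 * n - 1 = 4 * n./2 - 1 by lia.
have not_rev := level_not_reversed_modular N0; rewrite -m1 in not_rev.
split.
- exists nat, ar3, (level_identities false n./2); split=> //.
  + exact: gen_locally_finite.
  + rewrite {2}nE; exact: level_distributive.
  + move=> /modular_reversed_modular mod; apply: not_rev.
    by have -> : 2 * n - 1 = (2 * n - 2).+1 by lia.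
- exists nat, ar3, (level_identities true n./2); split=> //.
  + exact: gen_locally_finite.
  + rewrite {2}nE; exact: level_alvin.
  + have -> : 2 * n - 3 = 4 * n./2 - 3 by lia.
    exact: level_not_modular.
Qed.
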